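(* For all integers $m\geq 3$ and all powers $q$ of odd primes, there exists a CNS-quandle of order \[ \frac{(q^m-1)(q^{m-1}-1)}{q-1}, \] and for all integers $n\geq 5$ and $k$ such that $3\leq k\leq 2\lfloor n/2\rfloor$, there exists a CNS-quandle of order \[ \frac{n!}{k\,(n-k)!}. \]
   Context: A rack is a pair $R=(X,s)$ where $X$ is a nonempty set and $s:X\to S_X$, $x\mapsto s_x$, is a map to the symmetric group of $X$ with $s_xs_y=s_{s_x(y)}s_x$ for all $x,y\in X$; its order is $|X|$. It is a quandle if $s_x(x)=x$ for all $x$, and involutory if $s_x^2=\mathrm{id}_X$ for all $x$. It is connected if the group $\langle s_x\mid x\in X\rangle\leq S_X$ acts transitively on $X$. A good involution of $(X,s)$ is a map $\rho:X\to X$ with $\rho^2=\mathrm{id}_X$ such that $\rho s_x=s_x\rho$ and $s_{\rho(x)}=s_x^{-1}$ for all $x$. A symmetric quandle is a pair $(R,\rho)$ with $R$ a quandle and $\rho$ a good involution of $R$. A CNS-quandle is a symmetric quandle $(R,\rho)$ such that $R$ is connected and not involutory; its order is the order of $R$. *)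

(* Defs.v *)
From mathcomp Require Import all_boot all_order all_algebra all_fingroup.
Set Implicit Arguments.
Unset Strict Implicit.
Unset Printing Implicit Defensive.

Section Racks.
Local Open Scope group_scope.

Variables (X : finType) (s : X -> {perm X}).

(* The product of permutations is diagrammatic, (u * v) z = v (u z), so the
   axiom s_x s_y = s_{s_x(y)} s_x appears with its products reversed. *)
Definition is_rack : Prop :=
  0 < #|X| /\ forall x y : X, s y * s x = s x * s (s x y).

Definition is_quandle : Prop := is_rack /\ forall x : X, s x x = x.

Definition is_involutory : Prop := forall x : X, s x ^+ 2 = 1.

Definition is_connected : Prop :=
  [transitive <<[set s x | x : X]>>, on [set: X] | 'P].

Definition is_good_involution (rho : X -> X) : Prop :=
  [/\ forall x : X, rho (rho x) = x,
      forall x y : X, rho (s x y) = s x (rho y)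
    & forall x : X, s (rho x) = (s x)^-1].

Definition is_symmetric_quandle (rho : X -> X) : Prop :=
  is_quandle /\ is_good_involution rho.

Definition is_CNS_quandle (rho : X -> X) : Prop :=
  [/\ is_symmetric_quandle rho, is_connected & ~ is_involutory].

End Racks.

(* The order is compared in rat, so that the quotients in the statement are
   exact and no truncated operation on nat is involved. *)
Definition exists_CNS_quandle_of_order (N : rat) : Prop :=
  exists (X : finType) (s : X -> {perm X}) (rho : X -> X),
    is_CNS_quandle s rho /\ (#|X|%:R = N)%R.

Definition is_odd_prime_power (q : nat) : Prop :=
  exists p e : nat, [/\ prime p, odd p, 0 < e & q = p ^ e].

(* Main.v *)
(** The conjugacy class of transvections 1 + v f (with f v = 0) of GL_m(F_q) is a
    quandle under conjugation, and x |-> x^-1 is a good involution. For m >= 3 the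
    class is connected: conjugating by transvections one can replace v by any other
    nonzero vector of ker f, dually for f, and any two pairs (v, f), (w, h) are
    linked through a vector of ker f and ker h. A transvection is determined by
    (v, f) up to (c v, c^-1 f), whence the order.

    The second order is (k-1)! C(n, k). For k = 3 it is the number of 3-cycles, a
    generating set of the simple group Alt_n, which acts 3-transitively. The k-cycles
    themselves would not do for every k in the range: when k = n - 1 is odd they split
    into two Alt_n-classes. But for k >= 4 the order is a multiple 6 j of 6, and a
    CNS-quandle of any order 6 j lives on Z/3 x Z/2j: it deforms the quandle of
    reflections of the group G(2j, 2j, 3) by the element j of order 2, and
    generalizes the octahedral quandle (j = 1, the 4-cycles of S_4). *)

Require Import Defs.
From mathcomp Require Import all_boot all_order all_algebra all_fingroup.
From mathcomp Require Import gseries primitive_action alt mxabelem finfield.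
From mathcomp Require Import zify ring.
Set Implicit Arguments.
Unset Strict Implicit.
Unset Printing Implicit Defensive.
Import GRing.Theory.

(** * CNS-quandles from a binary operation *)

(** The first hypothesis makes each [op x] a permutation and identifies the one of [rho x] as its
    inverse. Transitivity is phrased through stable subsets [Y], to be applied to an orbit. *)
Lemma CNS_quandle_of_op (X : finType) (op : X -> X -> X) (rho : X -> X) :
    (forall x y, op (rho x) (op x y) = y) ->
    (forall x y z, op x (op y z) = op (op x y) (op x z)) ->
    (forall x, op x x = x) ->
    involutive rho ->
    (forall x y, rho (op x y) = op x (rho y)) ->
    (forall Y : {set X}, (forall z y, y \in Y -> op z y \in Y) ->
       forall x y, x \in Y -> y \in Y) ->
    (exists x y, op x (op x y) != y) ->
  exists_CNS_quandle_of_order #|X|%:R.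
Proof.
move=> opK opD opxx rhoK rhoM conn [x0 [y0 xy0]].
pose s x : {perm X} := perm (can_inj (opK x)).
have sE x y : s x y = op x y by rewrite permE.
exists X, s, rho; split=> //; split; last 1 first.
- move/(_ x0)/permP/(_ y0); rewrite expgS expg1 permM !sE perm1.
  exact/eqP.
- split; first split.
  + split; first by apply/card_gt0P; exists x0.
    by move=> x y; apply/permP=> z; rewrite !permM !sE opD.
  + by move=> x; rewrite sE.
  + split=> // [x y | x]; first by rewrite !sE.
    apply/permP=> y; apply: (@perm_inj _ (s x)).
    by rewrite permKV !sE -{1}[x]rhoK opK.
apply/imsetP; exists x0 => //; apply/esym/setP=> y; rewrite inE.
apply: (conn (orbit 'P <<[set s x | x : X]>> x0)%g) (orbit_refl _ _ _) => z u.
case/orbitP=> g gG <-; apply/orbitP; exists (g * s z)%g.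
  by rewrite groupM // mem_gen // imset_f.
by rewrite actM /= apermE sE.
Qed.

(** * The deformed quandle of reflections on Z/3 x A *)

Ltac eval_eq := repeat match goal with
  |- context [@eq_op ?T ?x ?y] =>
    let b := eval vm_compute in (@eq_op T x y) in
    change (@eq_op T x y) with b; cbv iota end.

(* [ring] does not use the hypothesis 2 c = 0, so multiples of 2 c are first added
   to the left-hand side with [addc] or [subc]. *)
Ltac ring_mod addc subc :=
  first [ring | apply: addc; ring | apply: subc; ring
        | apply: addc; apply: addc; ring | apply: subc; apply: subc; ring].

Section Reflections.
Local Open Scope ring_scope.
Variables (A : finComNzRingType) (c : A).

(* (i, a) with i in Z/3 encodes the reflection exchanging the coordinates i and i + 1
   up to the a-th power of a root of unity; c = 0 gives conjugation of reflections. *)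
Definition refl_op (x y : 'Z_3 * A) : 'Z_3 * A :=
  (- x.1 - y.1,
   if x.1 == y.1 then 2%:R * x.2 - y.2
   else - x.2 - y.2 + (y.1 == x.1 - 1)%:R * c).

Lemma CNS_reflections : c != 0 -> 2%:R * c = 0 ->
  exists_CNS_quandle_of_order #|{: 'Z_3 * A}|%:R.
Proof.
move=> c0 cc.
have Z3P (P : 'Z_3 -> Prop) : P 0 -> P 1 -> P 2%:R -> forall i, P i.
  move=> P0 P1 P2 -[[|[|[|//]]] hi].
  - by congr P: P0; apply: val_inj.
  - by congr P: P1; apply: val_inj.
  - by congr P: P2; apply: val_inj.
have addc (x y : A) : x + 2%:R * c = y -> x = y by rewrite cc addr0.
have subc (x y : A) : x - 2%:R * c = y -> x = y by rewrite cc subr0.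
apply: (@CNS_quandle_of_op _ refl_op (fun x => (x.1, x.2 + c))).
- move=> [i a] [j b]; rewrite /refl_op /=; congr pair; first by ring.
  elim/Z3P: i; elim/Z3P: j => /=; eval_eq; ring_mod addc subc.
- move=> [i x] [j y] [k z]; rewrite /refl_op /=; congr pair.
    by elim/Z3P: i; elim/Z3P: j; elim/Z3P: k; apply/val_inj.
  elim/Z3P: i; elim/Z3P: j; elim/Z3P: k => /=; eval_eq; ring_mod addc subc.
- move=> [i a]; rewrite /refl_op /= eqxx; congr pair; last by ring.
  by elim/Z3P: i; apply/val_inj.
- by move=> [i a] /=; congr pair; ring_mod addc subc.
- move=> [i a] [j b]; rewrite /refl_op /=; congr pair.
  by case: ifP => _; ring_mod addc subc.
- move=> Y YP.
  (* The acting element has the third index [- i - j]; its second coordinate is found by solving for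
     the target [b]. *)
  have step i a j b : i != j -> (i, a) \in Y -> (j, b) \in Y.
    move=> ij /(YP (- i - j, (i == - i - j - 1)%:R * c - a - b)).
    congr (_ \in Y); rewrite /refl_op /=; congr pair; first by ring.
    by elim/Z3P: i ij; elim/Z3P: j => //=; eval_eq => _; ring.
  have shift i a b : (i, a) \in Y -> (i, b) \in Y.
    have ii1 : i != i + 1 by elim/Z3P: i.
    by move=> /(step i a _ b ii1); apply: step; rewrite eq_sym.
  move=> [i a] [j b] iaY; have [ij|ij] := eqVneq i j.
    by rewrite -ij; apply: shift iaY.
  exact: step ij iaY.
(* Acting twice by [(0, 0)] sends [(1, 0)] to [(2, 0)], then to [(1, c)]. *)
- exists (0, 0), (1, 0); apply/eqP => /(congr1 snd) /=; eval_eq.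
  by move=> e; case/eqP: c0; rewrite -e; ring.
Qed.
End Reflections.

Lemma CNS_multiple_of_6 (j : nat) : 0 < j -> exists_CNS_quandle_of_order (6 * j)%:R.
Proof.
case: j => // j _.
have <- : #|{: 'Z_3 * 'Z_(2 * j.+1)}| = (6 * j.+1)%N.
  by rewrite card_prod !card_ord !Zp_cast //; lia.
apply: (@CNS_reflections 'Z_(2 * j.+1) j.+1%:R%R); last by rewrite -natrM pchar_Zp //; lia.
by rewrite -(inj_eq val_inj) /= val_Zp_nat ?modn_small //; lia.
Qed.

(** * Counting by fibres; quandles of conjugation *)

Lemma card_imset_fibers (T U : finType) (f : T -> U) (D : {set T}) (k : nat) :
    {in D, forall x, #|[set y in D | f y == f x]| = k} ->
  #|D| = #|f @: D| * k.
Proof.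
move=> fk; rewrite -sum1_card (partition_big_imset f) /= -sum_nat_const.
apply: eq_bigr => _ /imsetP[x Dx ->]; rewrite -(fk x Dx) -sum1_card.
by apply: eq_bigl => y; rewrite inE.
Qed.

Section Conjugation.
Local Open Scope group_scope.

(** An element of [<<C>>] is a product of elements of [C], so induction on the number of factors
    shows that a subset stable under conjugation by [C] contains whole classes. *)
Lemma CNS_conjugation (gT : finGroupType) (C : {set gT}) :
    {in C &, forall x y, y ^ x \in C} ->
    {in C, forall x, x^-1 \in C} ->
    {in C &, forall x y, y \in x ^: <<C>>} ->
    (exists x y, [/\ x \in C, y \in C & y ^ (x * x) != y]) ->
  exists_CNS_quandle_of_order #|C|%:R.
Proof.
move=> CJ CV Ctr [x0 [y0 [Cx0 Cy0 ncom]]].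
pose X : finType := {x | x \in C}.
pose op (x y : X) : X := Sub (val y ^ val x) (CJ _ _ (valP x) (valP y)).
pose rho (x : X) : X := Sub (val x)^-1 (CV _ (valP x)).
have -> : #|C| = #|{: X}| by rewrite card_sig.
apply: (@CNS_quandle_of_op _ op rho).
- by move=> x y; apply: val_inj; rewrite /= conjgK.
- by move=> x y z; apply: val_inj; rewrite /= conjJg.
- by move=> x; apply: val_inj; rewrite /= conjgE mulKg.
- by move=> x; apply: val_inj; rewrite /= invgK.
- by move=> x y; apply: val_inj; rewrite /= conjVg.
- move=> Y Yop x y Yx; have /imsetP[g] := Ctr _ _ (valP x) (valP y).
  case/gen_prodgP=> n [c cC ->] yE.
  suff : forall z : X, val z = val x ^ (\prod_(i < n) c i) -> z \in Y by exact.
  elim: n c cC {yE} => [|n IH] c cC z.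
    by rewrite big_ord0 conjg1 => /val_inj ->.
  rewrite big_ord_recr conjgM => zE; set w := (X in X ^ c ord_max) in zE.
  have Cw : w \in C.
    by rewrite -(conjgK (c ord_max) w) -zE CJ ?CV ?cC ?(valP z).
  have -> : z = op (Sub (c ord_max) (cC _)) (Sub w Cw) by apply: val_inj.
  by apply/Yop/(IH _ (fun i => cC _)).
- exists (Sub x0 Cx0), (Sub y0 Cy0); apply: contra ncom => /eqP /(congr1 val) /=.
  by rewrite -conjgM => ->.
Qed.

End Conjugation.

(** * The quandle of 3-cycles *)

Section ThreeCycles.
Local Open Scope group_scope.
Variable T : finType.

(** Products act from left to right: for distinct points this is x -> y -> z -> x. *)
Definition cyc3 (x y z : T) : {perm T} := tperm x y * tperm x z.

Lemma cyc3V x y z : (cyc3 x y z)^-1 = cyc3 x z y.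
Proof. by rewrite /cyc3 invMg !tpermV. Qed.

Lemma cyc3J x y z (g : {perm T}) : cyc3 x y z ^ g = cyc3 (g x) (g y) (g z).
Proof. by rewrite /cyc3 conjMg !tpermJ. Qed.

Lemma cyc3E x y z : uniq [:: x; y; z] -> [/\ cyc3 x y z x = y, cyc3 x y z y = z,
   cyc3 x y z z = x & forall u, u \notin [:: x; y; z] -> cyc3 x y z u = u].
Proof.
rewrite /= !inE negb_or !andbT => /andP[/andP[xy xz] yz].
split.
- by rewrite permM tpermL tpermD // eq_sym.
- by rewrite permM tpermR tpermL.
- by rewrite permM (tpermD xz yz) tpermR.
move=> u; rewrite !inE !negb_or => /and3P[ux uy uz].
by rewrite permM !tpermD // eq_sym.
Qed.

(** A permutation commutes with itself, and conjugating a 3-cycle by itself rotates its entries. *)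
Lemma cyc3_rot x y z : uniq [:: x; y; z] -> cyc3 y z x = cyc3 x y z.
Proof.
move=> /cyc3E[px py pz _]; rewrite -[RHS](mulKg (cyc3 x y z)) -conjgE.
by rewrite cyc3J px py pz.
Qed.

(** The value [1] is never taken, since the tuple has three entries. *)
Definition cyc3_tuple (t : 3.-tuple T) : {perm T} :=
  if val t is [:: x; y; z] then cyc3 x y z else 1.

Definition cycles3 := cyc3_tuple @: [set t : 3.-tuple T | uniq t].

Lemma cycles3P p :
  reflect (exists x y z, uniq [:: x; y; z] /\ p = cyc3 x y z) (p \in cycles3).
Proof.
apply: (iffP imsetP) => [[t] | [x [y [z [u ->]]]]].
  rewrite inE => tu ->; case: t tu => -[|x [|y [|z []]]] //= i u.
  by exists x, y, z.
by exists [tuple x; y; z]; rewrite ?inE.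
Qed.

(** A 3-cycle is written by exactly three tuples, the rotations of one of them. *)
Lemma card_cycles3 : #|T| ^_ 3 = (#|cycles3| * 3)%N.
Proof.
rewrite -(card_uniq_tuples 3 predT) -(@card_imset_fibers _ _ _ _ 3).
  by apply: eq_card => t; rewrite !inE all_predT.
case=> -[|x [|y [|z []]]] // i; rewrite inE [tval _]/= /cyc3_tuple => u.
have [px py pz pn] := cyc3E u.
have := u; rewrite /= !inE negb_or !andbT => /andP[/andP[xy xz] yz].
transitivity #|[set [tuple x; y; z]; [tuple y; z; x]; [tuple z; x; y]]|.
  apply: eq_card; case=> -[|a [|b [|c []]]] // j.
  rewrite 2!inE -[LHS]/(uniq [:: a; b; c] && (cyc3 a b c == cyc3 x y z)).
  apply/idP/idP; last first.
    rewrite !inE -orbA => /or3P[] /eqP /(congr1 val) [-> -> ->].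
    - by rewrite u eqxx.
    - by rewrite -(rot_uniq 1) in u; rewrite u cyc3_rot ?eqxx // -(rot_uniq 1).
    - by rewrite -(rot_uniq 2) in u; rewrite u -cyc3_rot ?eqxx.
  case/andP=> u' /eqP e; have := cyc3E u'; rewrite e => -[pa pb _ _].
  (* Otherwise [a] would be fixed, forcing [a = b]. Once [a] is known, [b] and [c] are its
     successive images. *)
  have : a \in [:: x; y; z].
    by apply: contraLR u' => /pn; rewrite pa => ->; rewrite /= inE eqxx.
  rewrite !inE -!val_eqE /= !eqseq_cons.
  by case/or3P => /eqP aE; rewrite -pb -pa aE ?px ?py ?pz ?px ?py ?pz !eqxx ?orbT.
rewrite -setUA cardsU1 cards2 !inE -!val_eqE /= !eqseq_cons.
by rewrite (negPf xy) (negPf xz) (negPf yz).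
Qed.

Lemma four_distinct : 4 < #|T| -> exists x y z w : T, uniq [:: x; y; z; w].
Proof.
have := enum_uniq T; rewrite cardE.
case: (enum T) => [|x [|y [|z [|w s]]]] // u _; exists x, y, z, w.
by have := take_uniq 4 u; rewrite /= take0.
Qed.

Lemma cycles3J p (g : {perm T}) : p \in cycles3 -> p ^ g \in cycles3.
Proof.
case/cycles3P=> x [y [z [u ->]]]; apply/cycles3P; rewrite cyc3J.
by exists (g x), (g y), (g z); rewrite -(map_inj_uniq (@perm_inj _ g)) in u.
Qed.

(** The 3-cycles are even and stable under conjugation, so they generate a nontrivial normal
    subgroup of a simple group. *)
Lemma gen_cycles3 : 4 < #|T| -> <<cycles3>> = 'Alt_T.
Proof.
move=> T5; have /simpleP[_ /(_ <<cycles3>>%G)] := simple_Alt5 T5.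
case=> [||->] //.
  apply/andP; split.
    rewrite gen_subG; apply/subsetP=> _ /cycles3P[x [y [z [u ->]]]].
    move: u; rewrite Alt_even odd_permM !odd_tperm /= !inE negb_or !andbT.
    by case/andP=> /andP[-> ->].
  apply: norms_gen; apply/subsetP=> g _; rewrite inE.
  by apply/subsetP=> _ /imsetP[p Cp ->]; apply: cycles3J.
move=> /= triv; have [x [y [z [w u]]]] := four_distinct T5.
have u3 : uniq [:: x; y; z] by have := take_uniq 3 u.
have : cyc3 x y z \in [1].
  by rewrite -triv mem_gen //; apply/cycles3P; exists x, y, z.
have [cx _ _ _] := cyc3E u3.
rewrite inE => /eqP/permP/(_ x); rewrite cx perm1 => yx.
by rewrite yx /= inE eqxx in u.
Qed.

Lemma CNS_cycles3 : 4 < #|T| -> exists_CNS_quandle_of_order #|cycles3|%:R.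
Proof.
move=> T5; apply: CNS_conjugation.
- by move=> x y _; apply: cycles3J.
- move=> _ /cycles3P[x [y [z [u ->]]]]; apply/cycles3P; rewrite cyc3V.
  exists x, z, y; split=> //.
  by rewrite -(@perm_uniq _ [:: x; y; z]) // perm_cons (perm_catC [:: y] [:: z]).
- move=> _ _ /cycles3P[x [y [z [u ->]]]] /cycles3P[a [b [c [v ->]]]].
  rewrite gen_cycles3 //.
  have tr : [transitive^3 'Alt_T, on setT | 'P].
    by apply: ntransitive_weak (Alt_trans T); rewrite -subn2; lia.
  have [||g Ag] := atransP2 tr (x := [tuple x; y; z]) (y := [tuple a; b; c]).
  + by rewrite inE u; apply/subsetP.
  + by rewrite inE v; apply/subsetP.
  by case=> -> -> ->; apply/imsetP; exists g; rewrite ?cyc3J.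
- have [x [y [z [w u]]]] := four_distinct T5.
  move: u; rewrite /= !inE !negb_or !andbT -!andbA => /and5P[xy xz xw yz /andP[yw zw]].
  have u3 : uniq [:: x; y; z] by rewrite /= !inE negb_or xy xz yz.
  have v3 : uniq [:: x; y; w] by rewrite /= !inE negb_or xy xw yw.
  have w3 : uniq [:: z; x; w] by rewrite /= !inE negb_or eq_sym xz zw xw.
  have wn : w \notin [:: x; y; z] by rewrite !inE !negb_or !(eq_sym w) xw yw zw.
  (* The square of the first conjugates the second to [cyc3 z x w], which sends [x] to [w] and not
     to [y]. *)
  exists (cyc3 x y z), (cyc3 x y w).
  split; try by apply/cycles3P; do 3!eexists; split; last by [].
  rewrite cyc3J 3!(permM (cyc3 x y z)).
  have [-> -> -> /(_ w wn) wE] := cyc3E u3; rewrite !wE.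
  apply: contra yw => /eqP/permP/(_ x).
  by have [_ -> _ _] := cyc3E w3; have [-> _ _ _] := cyc3E v3 => ->.
Qed.

End ThreeCycles.

Lemma CNS_three_cycles n : 4 < n -> exists_CNS_quandle_of_order (2 * 'C(n, 3))%:R.
Proof.
move=> n5; have := @CNS_cycles3 'I_n; have := card_cycles3 'I_n; rewrite card_ord.
move=> e; suff -> : (2 * 'C(n, 3))%N = #|cycles3 'I_n| by apply.
have := bin_ffact n 3; rewrite e -[3`!]/6; lia.
Qed.

(** * The quandle of transvections, in dimension [n.+1] *)

Section Transvections.
Local Open Scope ring_scope.
Variables (F : finFieldType) (n : nat).
Local Notation cV := 'cV[F]_n.+1.
Local Notation rV := 'rV[F]_n.+1.

Lemma dual_row (v : cV) : v != 0 -> exists f : rV, f *m v = 1%:M.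
Proof.
case/cV0Pn=> i vi; exists ((v i 0)^-1 *: delta_mx 0 i).
rewrite -scalemxAl -rowE [row i v]mx11_scalar scale_scalar_mx.
by rewrite [row i v 0 0]mxE mulVf.
Qed.

Lemma dual_col (f : rV) : f != 0 -> exists v : cV, f *m v = 1%:M.
Proof.
rewrite -trmx_eq0 => /dual_row[g /(congr1 trmx)].
by rewrite trmx_mul trmxK tr_scalar_mx; exists g^T.
Qed.

(** Two linear conditions in dimension at least 3 leave a nonzero solution. *)
Lemma row_killing2 (v w : cV) : (1 < n)%N ->
  exists f : rV, [/\ f != 0, f *m v = 0 & f *m w = 0].
Proof.
move=> n1; have : kermx (row_mx v w) != 0.
  rewrite -mxrank_eq0 mxrank_ker; have := rank_leq_col (row_mx v w); lia.
case/rowV0Pn=> f /sub_kermxP; rewrite mul_mx_row -row_mx0 => /eq_row_mx[fv fw] f0.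
by exists f.
Qed.

Lemma col_killing2 (f h : rV) : (1 < n)%N ->
  exists v : cV, [/\ v != 0, f *m v = 0 & h *m v = 0].
Proof.
case/(row_killing2 f^T h^T)=> g [g0 gf gh]; exists g^T; rewrite trmx_eq0 g0.
by split=> //; apply: trmx_inj; rewrite trmx_mul trmxK ?gf ?gh trmx0.
Qed.

Lemma mx1_neq0 (p : nat) (v : 'M[F]_(1, p)) (w : 'M_(p, 1)) :
  v *m w = 1%:M -> v != 0 /\ w != 0.
Proof.
have one0 : 1%:M != 0 :> 'M[F]_1 by exact: oner_neq0.
move=> vw; split; apply: contraNneq one0 => z; rewrite -vw z ?mul0mx ?mulmx0 //.
Qed.

(** The default [1] is for a matrix that is not invertible; [f *m v = 0] excludes this, [1 - v f]
    being the inverse. *)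
Definition transvection (v : cV) (f : rV) : {unit 'M[F]_n.+1} :=
  insubd (1%g : {unit 'M[F]_n.+1}) (1%:M + v *m f).

Lemma transvection_mulN (v : cV) (f : rV) : f *m v = 0 ->
  (1%:M + v *m f) *m (1%:M - v *m f) = 1%:M.
Proof.
move=> fv; rewrite mulmxDl mul1mx mulmxBr mulmx1 mulmxA.
by rewrite -(mulmxA v) fv mulmx0 mul0mx subr0 subrK.
Qed.

Lemma val_transvection v f : f *m v = 0 ->
  val (transvection v f) = 1%:M + v *m f.
Proof.
move=> fv; rewrite val_insubd ifT //.
by have /mulmx1_unit[] := transvection_mulN fv.
Qed.

Lemma transvectionV v f : f *m v = 0 ->
  (transvection v f)^-1%g = transvection (- v) f.
Proof.
move=> fv; apply/eqP; rewrite eq_invg_mul; apply/eqP/val_inj => /=.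
rewrite !val_transvection ?mulmxN ?fv ?oppr0 //.
by rewrite mulNmx; apply: transvection_mulN.
Qed.

(** The factors are [h (1 + v f)] and [(1 - v f) w], so their product is [h w = 0]. *)
Lemma mulmx_conj0 (v w : cV) (f h : rV) : f *m v = 0 -> h *m w = 0 ->
  (h + h *m v *m f) *m (w - v *m (f *m w)) = 0.
Proof.
move=> fv hw.
rewrite mulmxDl !mulmxBr hw !mulmxA -(mulmxA (h *m v) f v) fv mulmx0 !mul0mx.
by rewrite subr0 sub0r addNr.
Qed.

Lemma transvectionJ v f w h : f *m v = 0 -> h *m w = 0 ->
  (transvection w h ^ transvection v f)%g =
  transvection (w - v *m (f *m w)) (h + (h *m v) *m f).
Proof.
move=> fv hw.
have fv' : f *m - v = 0 by rewrite mulmxN fv oppr0.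
have hw' : (h + h *m v *m f) *m (w - v *m (f *m w)) = 0 by exact: mulmx_conj0.
apply: val_inj; rewrite conjgE transvectionV //.
rewrite [LHS]/= !val_transvection // -!mulmxE.
have e : (1%:M + - v *m f) *m (1%:M + v *m f) = 1%:M.
  by have := transvection_mulN fv'; rewrite mulNmx opprK.
rewrite (mulmxDl 1%:M (w *m h)) mul1mx (mulmxDr (1%:M + - v *m f)) e.
congr (_ + _).
rewrite -(mulmxA w h) (mulmxA _ w); congr (_ *m _).
  by rewrite mulmxDl mul1mx !mulNmx mulmxA.
by rewrite mulmxDr mulmx1 mulmxA.
Qed.

Definition transvections : {set {unit 'M[F]_n.+1}} :=
  [set transvection p.1 p.2 | p in
    [set p : cV * rV | [&& p.1 != 0, p.2 != 0 & p.2 *m p.1 == 0]]].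

Lemma transvectionsP x :
  reflect (exists v f, [/\ v != 0, f != 0, f *m v = 0 & x = transvection v f])
          (x \in transvections).
Proof.
apply: (iffP imsetP) => [[[v f]] | [v [f [v0 f0 fv ->]]]].
  by rewrite inE => /and3P[/= v0 f0 /eqP fv] ->; exists v, f.
by exists (v, f); rewrite ?inE //= v0 f0 fv eqxx.
Qed.

Local Notation sim x y := (y \in (x ^: <<transvections>>)%g).

Lemma sim_move (v u : cV) (f g : rV) : u != 0 -> g != 0 -> g *m u = 0 -> f *m v = 0 ->
  sim (transvection v f)
      (transvection (v - u *m (g *m v)) (f + (f *m u) *m g)).
Proof.
move=> u0 g0 gu fv; rewrite -transvectionJ //; apply: memJ_class.
by apply/mem_gen/transvectionsP; exists u, g.
Qed.

Lemma sim_col1 (v w : cV) (f g : rV) : w != 0 -> f *m v = 0 -> f *m w = 0 ->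
    g *m v = 1%:M -> g *m w = 0 ->
  sim (transvection v f) (transvection w f).
Proof.
move=> w0 fv fw gv gw; have [h hw] := dual_row w0.
(* k takes the value 1 on both v and w, so v - w and k define a transvection
   moving v to w. *)
pose k := h + (1%:M - h *m v) *m g.
have kw : k *m w = 1%:M by rewrite mulmxDl hw -mulmxA gw mulmx0 addr0.
have kv : k *m v = 1%:M by rewrite mulmxDl -mulmxA gv mulmx1 addrC subrK.
have := @sim_move v (v - w) f k; rewrite kv mulmx1 subKr (mulmxBr f) fv fw subr0.
rewrite mul0mx addr0; apply=> //; last by rewrite mulmxBr kv kw subrr.
  by have := @mx1_neq0 _ g (v - w); rewrite mulmxBr gv gw subr0 => -[].
by have [] := mx1_neq0 kw.
Qed.

(** Dually to [sim_col1], [f] and [h] both take the value 1 on [k], so the transvection of [k] and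
    [h - f] fixes [v] and moves [f] to [h]. *)
Lemma sim_row1 (v u : cV) (f h : rV) : h != 0 -> f *m v = 0 -> h *m v = 0 ->
    f *m u = 1%:M -> h *m u = 0 ->
  sim (transvection v f) (transvection v h).
Proof.
move=> h0 fv hv fu hu; have [w hw] := dual_col h0.
pose k := w + u *m (1%:M - f *m w).
have hk : h *m k = 1%:M by rewrite mulmxDr hw mulmxA hu mul0mx addr0.
have fk : f *m k = 1%:M by rewrite mulmxDr mulmxA fu mul1mx addrC subrK.
have := @sim_move v k f (h - f); rewrite fk mul1mx (addrC f) subrK (mulmxBl h f v) fv hv subr0.
rewrite mulmx0 subr0; apply=> //; last by rewrite mulmxBl fk hk subrr.
  by have [] := mx1_neq0 hk.
have := @mx1_neq0 _ (f - h) u; rewrite mulmxBl fu hu subr0 -opprB oppr_eq0.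
by case.
Qed.

Lemma sim_col (v w : cV) (f : rV) : (1 < n)%N -> v != 0 -> w != 0 -> f *m v = 0 ->
  f *m w = 0 -> sim (transvection v f) (transvection w f).
Proof.
move=> n1 v0 w0 fv fw; have [g gv] := dual_row v0.
have [gw | gw] := eqVneq (g *m w) 0; first exact: sim_col1 gv gw.
(* When [g] does not kill [w], pass through a vector [x] killed by [f] and [g]: [g] separates [v]
   from [x], and a multiple of [g] separates [w] from [x]. *)
have [x [x0 fx gx]] := col_killing2 f g n1.
apply: (class_trans (y := transvection x f)); last exact: sim_col1 gv gx.
have := mx11_scalar (g *m w); set c := (_ 0 0) => ce.
have c0 : c != 0 by apply: contraNneq gw => z; rewrite ce z raddf0.
rewrite class_sym; apply: (@sim_col1 _ _ _ (c^-1 *: g)) => //.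
  by rewrite -scalemxAl ce scale_scalar_mx mulVf.
by rewrite -scalemxAl gx scaler0.
Qed.

Lemma sim_row (v : cV) (f h : rV) : (1 < n)%N -> f != 0 -> h != 0 -> f *m v = 0 ->
  h *m v = 0 -> sim (transvection v f) (transvection v h).
Proof.
move=> n1 f0 h0 fv hv; have [u fu] := dual_col f0.
have [hu | hu] := eqVneq (h *m u) 0; first exact: sim_row1 fu hu.
have [x [x0 xv xu]] := row_killing2 v u n1.
apply: (class_trans (y := transvection v x)); last exact: sim_row1 fu xu.
have := mx11_scalar (h *m u); set c := (_ 0 0) => ce.
have c0 : c != 0 by apply: contraNneq hu => z; rewrite ce z raddf0.
rewrite class_sym; apply: (@sim_row1 _ (c^-1 *: u)) => //.
  by rewrite -scalemxAr ce scale_scalar_mx mulVf.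
by rewrite -scalemxAr xu scaler0.
Qed.

Lemma CNS_transvections : (1 < n)%N -> 2%:R != 0 :> F ->
  exists_CNS_quandle_of_order #|transvections|%:R.
Proof.
move=> n1 two0; apply: CNS_conjugation.
- move=> _ _ /transvectionsP[v [f [v0 f0 fv ->]]] /transvectionsP[w [h [w0 h0 hw ->]]].
  rewrite transvectionJ //; apply/transvectionsP; do 2!eexists; split; last by [].
  + apply: contraNneq w0 => /eqP; rewrite subr_eq0 => /eqP e.
    have fw : f *m w = 0 by rewrite e mulmxA fv mul0mx.
    by rewrite e fw mulmx0.
  + apply: contraNneq h0 => /eqP; rewrite addr_eq0 => /eqP e.
    have hv : h *m v = 0 by rewrite e mulNmx -(mulmxA (h *m v)) fv mulmx0 oppr0.
    by rewrite e hv mul0mx oppr0.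
  + exact: mulmx_conj0.
- move=> _ /transvectionsP[v [f [v0 f0 fv ->]]]; apply/transvectionsP.
  exists (- v), f; rewrite oppr_eq0 transvectionV //.
  by split=> //; rewrite mulmxN fv oppr0.
- move=> _ _ /transvectionsP[v [f [v0 f0 fv ->]]] /transvectionsP[w [h [w0 h0 hw ->]]].
  have [x [x0 fx hx]] := col_killing2 f h n1.
  apply: class_trans (sim_col n1 v0 x0 fv fx).
  apply: class_trans (sim_row n1 f0 h0 fx hx).
  exact: sim_col.
(* With [f w = 1] and [h] killing [v] and [w], conjugating twice turns [(w, h)] into [(w - 2 v, h)];
   equality would give [2 v = 0], against [two0]. *)
- have [v [v0 _ _]] := col_killing2 0 0 n1.
  have [f [f0 fv _]] := row_killing2 v v n1.
  have [w fw] := dual_col f0; have [_ w0] := mx1_neq0 fw.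
  have [h [h0 hv hw]] := row_killing2 v w n1.
  exists (transvection v f), (transvection w h).
  split; [by apply/transvectionsP; exists v, f | by apply/transvectionsP; exists w, h |].
  rewrite conjgM transvectionJ // hv mul0mx addr0 fw mulmx1.
  have hwv : h *m (w - v) = 0 by rewrite mulmxBr hw hv subr0.
  rewrite transvectionJ // hv mul0mx addr0 mulmxBr fw fv subr0 mulmx1.
  apply: contra v0 => /eqP/(congr1 val).
  have hwvv : h *m (w - v - v) = 0 by rewrite mulmxBr hwv hv subr0.
  have [y hy] := dual_col h0.
  rewrite !val_transvection // => /addrI/(congr1 (mulmx^~ y)).
  rewrite -!mulmxA hy !mulmx1 -addrA => /(canRL (addKr _)); rewrite addNr.
  by rewrite -opprD => /eqP; rewrite oppr_eq0 -mulr2n -scaler_nat scaler_eq0 (negPf two0).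
Qed.

(** Both sides count the pairs [(v, f)]: by choosing [v], then [f] in its annihilator of dimension
    [n]; and by fibres, which are free orbits of the nonzero scalars. *)
Lemma card_transvections :
  ((#|F| ^ n.+1 - 1) * (#|F| ^ n - 1) = #|transvections| * (#|F| - 1))%N.
Proof.
rewrite -(@card_imset_fibers _ _ _ _ (#|F| - 1)); last first.
  case=> v f; rewrite inE => /and3P[/= v0 f0 /eqP fv].
  have [g gv] := dual_row v0; have [y fy] := dual_col f0.
  pose scal (c : F) : cV * rV := (c *: v, c^-1 *: f).
  transitivity #|[set scal c | c in [set~ 0]]|.
    apply: eq_card => -[w h]; rewrite !inE /=; apply/idP/imsetP.
      case/andP=> /and3P[w0 h0 /eqP hw] /eqP /(congr1 val).
      rewrite !val_transvection // => /addrI e.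
      (* Multiplying [w h = v f] by [y] on the right gives [v = d w], and by [g] on the left gives
         [f = c h]. *)
      have := mx11_scalar (g *m w); set c := (_ 0 0) => ce.
      have := mx11_scalar (h *m y); set d := (_ 0 0) => de.
      have vE : v = d *: w by rewrite -mul_mx_scalar -de mulmxA e -mulmxA fy mulmx1.
      have fE : f = c *: h by rewrite -mul_scalar_mx -ce -mulmxA e mulmxA gv mul1mx.
      have dc : d * c = 1.
        move: gv; rewrite vE -scalemxAr ce scale_scalar_mx.
        by move/matrixP/(_ 0 0); rewrite !mxE.
      have c0 : c != 0 by apply: contraNneq f0 => z; rewrite fE z scale0r.
      exists c; rewrite ?inE // /scal; congr pair.
        by rewrite vE scalerA mulrC dc scale1r.
      by rewrite fE scalerA mulVf // scale1r.
    case=> c; rewrite !inE => c0 [-> ->].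
    rewrite !scaler_eq0 invr_eq0 (negPf c0) v0 f0 -scalemxAr -scalemxAl fv !scaler0 eqxx /=.
    apply/eqP/val_inj; rewrite !val_transvection -?scalemxAr -?scalemxAl ?fv ?scaler0 //.
    by rewrite scalerA mulVf // scale1r.
  rewrite card_in_imset ?cardsC1 ?subn1 // => a b _ _ [] /(congr1 (mulmx g)).
  rewrite -!scalemxAr gv !scalemx1 => /(congr1 (fun M : 'M_1 => M 0 0)).
  by rewrite !mxE.
rewrite -sum1_card.
rewrite (eq_bigl (fun p : cV * rV => (p.1 != 0) && ((p.2 != 0) && (p.2 *m p.1 == 0)))).
  rewrite -(pair_big_dep (fun v : cV => v != 0)
              (fun (v : cV) (f : rV) => (f != 0) && (f *m v == 0)) (fun _ _ => 1%N)) /=.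
  transitivity (\sum_(v : cV | v != 0%R) (#|F| ^ n - 1))%N.
    rewrite sum_nat_const; congr (_ * _)%N.
    by rewrite cardC1 card_mx muln1 subn1.
  apply: eq_bigr => v v0.
  have -> : (#|F| ^ n - 1 = #|rowg (kermx v) :\ 0%R|)%N.
    have := cardsD1 0 (rowg (kermx v)); rewrite mem_rowg sub0mx card_rowg.
    rewrite mxrank_ker -mxrank_tr rank_rV trmx_eq0 v0 /= subSS subn0 => ->.
    by rewrite addnC addnK.
  rewrite -sum1_card; apply: eq_bigl => f.
  by rewrite in_setD1 mem_rowg sub_kermx.
by move=> p; rewrite inE.
Qed.
End Transvections.

(** * The two families of orders *)

Lemma CNS_cycles_order (n k : nat) : 4 < n -> 2 < k <= n ->
  exists_CNS_quandle_of_order (k.-1`! * 'C(n, k))%:R.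
Proof.
move=> n5 /andP[k3 kn]; have [-> | k4] := eqVneq k 3; first exact: CNS_three_cycles.
(* From here on [(k - 1)!] contains the factor [3! = 6]. *)
have k1 : 3 <= k.-1 by lia.
rewrite (fact_split k1) -mulnA; apply: CNS_multiple_of_6.
rewrite muln_gt0 bin_gt0 kn andbT; have := fact_gt0 k.-1.
by rewrite (fact_split k1) muln_gt0 => /andP[].
Qed.

Theorem proposition1p8 :
  (forall m q : nat, 3 <= m -> is_odd_prime_power q ->
     exists_CNS_quandle_of_order
       ((q%:R ^+ m - 1) * (q%:R ^+ (m - 1)%N - 1) / (q%:R - 1))%R)
  /\
  (forall n k : nat, 5 <= n -> 3 <= k -> k <= 2 * (n %/ 2) ->
     exists_CNS_quandle_of_order
       (n`!%:R / (k%:R * (n - k)`!%:R))%R).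
Proof.
split=> [m q m3 [p [e [p_pr p_odd e0 qE]]] | n k n5 k3 kn].
  have [F Fp Fq] := pPrimePowerField p_pr e0.
  have two0 : (2%:R != 0 :> F)%R.
    (* If 2 vanished in [F], the odd characteristic [p] would divide 2. *)
    by rewrite -(dvdn_pcharf Fp) dvdn_prime2 //; apply: contraL p_odd => /eqP ->.
  case: m m3 => // n n1; have := CNS_transvections n1 two0.
  have q1 : 1 < q by rewrite qE -Fq; apply: finNzRing_gt1.
  suff -> : (#|transvections F n|%:R =
      (q%:R ^+ n.+1 - 1) * (q%:R ^+ (n.+1 - 1)%N - 1) / (q%:R - 1) :> rat)%R by [].
  have := card_transvections F n; rewrite Fq -qE => /(congr1 (fun i => i%:R%R : rat)).
  rewrite !natrM !natrB ?expn_gt0 ?(ltnW q1) // !natrX subn1 /= => ->.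
  by rewrite mulfK // subr_eq0 Num.Theory.pnatr_eq1 gtn_eqF.
have kn' : k <= n by have := leq_trunc_div n 2; lia.
suff -> : (n`!%:R / (k%:R * (n - k)`!%:R) = (k.-1`! * 'C(n, k))%:R :> rat)%R.
  by apply: CNS_cycles_order; rewrite // k3.
rewrite -(bin_fact kn'); case: k k3 {kn kn'} => // k _.
rewrite factS !natrM /=.
have := fact_gt0 (n - k.+1); have := fact_gt0 k; set a := (n - k.+1)`!; set b := k`!.
by move=> b0 a0; field; rewrite -(natrD _ 1) !Num.Theory.pnatr_eq0 -lt0n a0.
Qed.
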